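(* There exist constants $c>0$ and $n_0\ge 3$ such that for every integer $n\ge n_0$, setting $N=r(n,n)$, we have \[ \tilde{r}(n,n;N)\le \binom{N}{2}-c\,N\log N . \] That is, $\tilde{r}(n,n;r(n,n))\le \binom{N}{2}-\Omega(N\log N)$.
   Context: For integers $m,n\ge 3$, $r(m,n)$ denotes the classical Ramsey number: the least $N$ such that every red/blue colouring of the edges of $K_N$ contains a red $K_m$ or a blue $K_n$. The restricted $(m,n;N)$-online Ramsey game is played by two players, Builder and Painter, on a set of $N$ initially isolated vertices. In each turn Builder chooses a pair of currently non-adjacent vertices and builds the edge between them, and Painter then colours that edge red or blue. Builder wins once a red $K_m$ or a blue $K_n$ is present. The restricted online Ramsey number $\tilde{r}(m,n;N)$ (defined when $N\ge r(m,n)$) is the minimum number $t$ such that Builder has a strategy guaranteeing a win within $t$ turns, whatever Painter does. *)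

(* Defs.v *)
From mathcomp Require Import all_boot.
From Stdlib Require Import Reals.

Set Implicit Arguments.
Unset Strict Implicit.
Unset Printing Implicit Defensive.

(* A red/blue colouring of the edges of K_N: a symmetric map on pairs of
   vertices of 'I_N (true = red, false = blue); values on the diagonal are
   irrelevant. *)
Definition sym_colouring (N : nat) (col : 'I_N -> 'I_N -> bool) : Prop :=
  forall x y, col x y = col y x.

Definition mono_clique (N : nat) (col : 'I_N -> 'I_N -> bool) (b : bool)
    (S : {set 'I_N}) : Prop :=
  forall x y, x \in S -> y \in S -> x != y -> col x y = b.

Definition ramsey_arrow (m n N : nat) : Prop :=
  forall col : 'I_N -> 'I_N -> bool, sym_colouring col ->
    (exists S : {set 'I_N}, #|S| = m /\ mono_clique col true S) \/
    (exists S : {set 'I_N}, #|S| = n /\ mono_clique col false S).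

Definition is_ramsey_number (m n N : nat) : Prop :=
  ramsey_arrow m n N /\ forall M, M < N -> ~ ramsey_arrow m n M.

(* Game position: for each pair of vertices, None = not yet built,
   Some true = built and coloured red, Some false = built and coloured blue. *)
Definition position (N : nat) := 'I_N -> 'I_N -> option bool.

Definition empty_position (N : nat) : position N := fun _ _ => None.

Definition add_edge (N : nat) (s : position N) (x y : 'I_N) (c : bool)
    : position N :=
  fun u v => if ((u == x) && (v == y)) || ((u == y) && (v == x))
             then Some c else s u v.

Definition pos_mono_clique (N : nat) (s : position N) (b : bool)
    (S : {set 'I_N}) : Prop :=
  forall x y, x \in S -> y \in S -> x != y -> s x y = Some b.

Definition builder_has_won (m n N : nat) (s : position N) : Prop :=
  (exists S : {set 'I_N}, #|S| = m /\ pos_mono_clique s true S) \/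
  (exists S : {set 'I_N}, #|S| = n /\ pos_mono_clique s false S).

Inductive builder_wins_within (m n N : nat) : nat -> position N -> Prop :=
  | bww_won t s : builder_has_won m n s -> builder_wins_within m n t s
  | bww_move t s (x y : 'I_N) :
      x != y -> s x y = None ->
      (forall c : bool, builder_wins_within m n t (add_edge s x y c)) ->
      builder_wins_within m n t.+1 s.

Definition builder_wins (m n N t : nat) : Prop :=
  @builder_wins_within m n N t (@empty_position N).

(* Main.v *)
Require Import Defs.
From mathcomp Require Import all_boot.
From Stdlib Require Import Reals.
From Stdlib Require Import Classical Lra.
From mathcomp Require Import ssrnat zify.

Set Implicit Arguments.
Unset Strict Implicit.
Unset Printing Implicit Defensive.

(** Builder aims at a position in which the unbuilt edges form two sets [E1], [E2]
    of size at least of order N log N, such that no monochromatic clique can use edges of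
    both. Whatever cannot be completed safely is then already lost within [E1]
    alone or within [E2] alone, so one of the two sets need not be built.

    The two sets are P x W and A x B, where |P| ~ c log N, |W| ~ N/2, and each
    vertex of P is joined to all of A in one colour and to all of B in the other:
    no monochromatic clique meets P, A and B. To find P, A and B, Builder joins a
    vertex y of A to the rest of A u B. If both colours can be kept on a constant
    fraction, one on A and the other on B, y goes to P. Otherwise y is almost
    monochromatic on A u B; it joins the red clique or the blue clique of such
    vertices, which happens fewer than 2n = O(log N) times before one of them has n
    vertices. Since N is exponential in n, A and B stay of size N^(15/16). *)

(** * Positions, savings and batches of moves *)

Definition sym_position N (s : position N) : Prop := forall x y, s x y = s y x.

Definition unbuilt N (s : position N) : {set 'I_N * 'I_N} :=
  [set q | (q.1 != q.2) && (s q.1 q.2 == None)].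

(* Builder can win from [s] leaving [G] of the edges unbuilt; [unbuilt] counts
   ordered pairs, hence the doubling. *)
Definition saves n N (G : nat) (s : position N) : Prop :=
  exists t, (t + G).*2 <= #|unbuilt s| /\ builder_wins_within n n t s.

(** The possible outcomes of building every unbuilt edge of [E]: Painter's colours are arbitrary,
    and the order of the moves leaves no trace. *)
Definition completes N (E : rel 'I_N) (s s' : position N) : Prop :=
  [/\ sym_position s',
      forall x y c, s x y = Some c -> s' x y = Some c
    & forall x y, x != y -> (s' x y == None) = (s x y == None) && ~~ E x y].

Lemma builder_wins_within_le m n N t t' (s : position N) :
  t <= t' -> builder_wins_within m n t s -> builder_wins_within m n t' s.
Proof.
move=> le_tt' win; elim: win t' le_tt' => {t s} [t s won|t s x y xy sxy _ IH] t' le_tt'.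
  exact: bww_won.
case: t' le_tt' => // t' le_tt'.
by apply: (bww_move xy sxy) => c; apply: IH.
Qed.

Lemma add_edge_sym N (s : position N) x y c :
  sym_position s -> sym_position (add_edge s x y c).
Proof.
move=> s_sym u v; rewrite /add_edge (s_sym u v) orbC.
by rewrite [(u == y) && _]andbC [(u == x) && _]andbC.
Qed.

Lemma add_edge_built N (s : position N) x y c u v d :
  sym_position s -> s x y = None -> s u v = Some d -> add_edge s x y c u v = Some d.
Proof.
move=> s_sym sxy suv; rewrite /add_edge; case: ifP => // /orP[] /andP[/eqP eu /eqP ev].
  by rewrite -eu -ev suv in sxy.
by rewrite s_sym -eu -ev suv in sxy.
Qed.

Lemma unbuilt_add_edge N (s : position N) x y c :
  sym_position s -> x != y -> s x y = None ->
  #|unbuilt s| = (#|unbuilt (add_edge s x y c)| + 2)%N.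
Proof.
move=> s_sym xy sxy.
have -> : unbuilt (add_edge s x y c) = unbuilt s :\: [set (x, y); (y, x)].
  apply/setP => -[u v]; rewrite !inE /= /add_edge !xpair_eqE.
  by case: ifP => _ //=; rewrite andbF.
have sub : [set (x, y); (y, x)] \subset unbuilt s.
  apply/subsetP => -[u v]; rewrite !inE !xpair_eqE => /orP[] /andP[/eqP-> /eqP->] /=.
    by rewrite xy sxy.
  by rewrite eq_sym xy s_sym sxy.
have c2 : #|[set (x, y); (y, x)]| = 2 by rewrite cards2 xpair_eqE (negPf xy).
by rewrite cardsD (setIidPr sub) c2 subnK // -c2 subset_leq_card.
Qed.

Lemma saves_move n N G (s : position N) x y :
  sym_position s -> x != y -> s x y = None ->
  (forall c, saves n G (add_edge s x y c)) -> saves n G s.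
Proof.
move=> s_sym xy sxy win.
have [t1 [le1 w1]] := win true; have [t2 [le2 w2]] := win false.
have e1 := unbuilt_add_edge true s_sym xy sxy.
have e2 := unbuilt_add_edge false s_sym xy sxy.
exists (maxn t1 t2).+1; split; first by lia.
apply: (bww_move xy sxy) => -[].
  by apply: builder_wins_within_le w1; lia.
by apply: builder_wins_within_le w2; lia.
Qed.

(** Builder may build all of [E] without regard to the answers in between: each edge costs one turn
    and removes one unbuilt edge, so the saving [G] is unaffected. *)
Lemma saves_batch n N G (E : rel 'I_N) (s : position N) :
  symmetric E -> sym_position s ->
  (forall s', completes E s s' -> saves n G s') -> saves n G s.
Proof.
move=> E_sym.
have [k] := ubnP #|[set q in unbuilt s | E q.1 q.2]|.
elim: k s => // k IH s; rewrite ltnS => le_k s_sym win.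
have [e0|] := set_0Vmem [set q in unbuilt s | E q.1 q.2].
  apply: win; split=> // x y xy.
  have := in_set0 (x, y); rewrite -e0 !inE /= xy /=.
  by case: (s x y == None) => //= ->.
move=> [[x y]]; rewrite !inE /= => /andP[/andP[xy /eqP sxy] Exy].
apply: (saves_move s_sym xy sxy) => c; apply: IH.
- apply: leq_trans le_k; apply: proper_card; apply/properP; split.
    apply/subsetP => -[u v]; rewrite !inE /= /add_edge.
    by case: ifP => //=; rewrite ?andbF.
  exists (x, y); first by rewrite !inE /= xy sxy Exy.
  by rewrite !inE /= /add_edge !eqxx /= andbF.
- exact: add_edge_sym.
move=> s' [s'_sym ext dom]; apply: win; split=> //.
  by move=> u v d suv; apply: ext; apply: add_edge_built.
move=> u v uv; rewrite (dom u v uv) /add_edge.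
case: ifP => // /orP[] /andP[/eqP-> /eqP->]; first by rewrite Exy !andbF.
by rewrite E_sym Exy !andbF.
Qed.

Lemma unbuilt_completes N (E : rel 'I_N) (s s' : position N) :
  completes E s s' ->
  unbuilt s' = [set q in unbuilt s | ~~ E q.1 q.2].
Proof.
move=> [_ _ dom]; apply/setP => -[x y]; rewrite !inE /=.
by case xy: (x != y) => //=; rewrite dom.
Qed.

(** * Two sets of edges that no monochromatic clique mixes *)

(* The completions of [E1] without a monochromatic clique and those of [E2] glue
   to a colouring of the whole graph whose cliques lie in one of the two, so one
   of the two sets is won on its own and the other one stays unbuilt. *)
Lemma saves_split n N G (E1 E2 : rel 'I_N) (s : position N) :
  ramsey_arrow n n N -> sym_position s -> symmetric E1 -> symmetric E2 ->
  (forall x y, x != y -> (s x y == None) = E1 x y || E2 x y) ->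
  (forall x y, ~~ (E1 x y && E2 x y)) ->
  (forall x y a b c, E1 x y -> E2 a b ->
     exists u v, [/\ u \in [:: x; y; a; b], v \in [:: x; y; a; b], u != v
                   & s u v = Some (~~ c)]) ->
  G.*2 <= #|[set q | (q.1 != q.2) && E1 q.1 q.2]| ->
  G.*2 <= #|[set q | (q.1 != q.2) && E2 q.1 q.2]| ->
  saves n G s.
Proof.
move=> arrow s_sym E1_sym E2_sym dom dis sep le1 le2.
have win (F F' : rel 'I_N) : symmetric F ->
    (forall x y, x != y -> (s x y == None) = F x y || F' x y) ->
    (forall x y, ~~ (F x y && F' x y)) ->
    G.*2 <= #|[set q | (q.1 != q.2) && F' q.1 q.2]| ->
    (forall s', completes F s s' -> builder_has_won n n s') -> saves n G s.
  move=> F_sym domF disF leF winF; apply: (saves_batch F_sym s_sym) => s' comp.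
  exists 0; split; last by apply: bww_won; apply: winF.
  apply: leq_trans leF _; rewrite (unbuilt_completes comp).
  apply/subset_leq_card/subsetP => -[x y]; rewrite !inE /= => /andP[xy F'xy].
  by rewrite xy domF // F'xy orbT; move: (disF x y); rewrite F'xy andbT.
have [w1|nw1] := classic (forall s', completes E1 s s' -> builder_has_won n n s').
  exact: (win E1 E2).
have [s1 nw1'] := not_all_ex_not _ _ nw1.
have {nw1 nw1'}[comp1 lose1] := imply_to_and _ _ nw1'.
apply: (win E2 E1) => //.
- by move=> x y xy; rewrite dom // orbC.
- by move=> x y; rewrite andbC.
move=> s2 comp2; apply: NNPP => lose2.
case: comp1 comp2 => s1_sym ext1 dom1 [s2_sym ext2 dom2].
(* Off the diagonal [s1] or [s2] always supplies a colour, as [E1] and [E2] cover the unbuilt pairs;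
   the default [true] matters only on the diagonal. *)
pose col x y := if s1 x y is Some c then c else odflt true (s2 x y).
have col_sym : sym_colouring col by move=> x y; rewrite /col s1_sym s2_sym.
have col_built x y c : s x y = Some c -> col x y = c.
  by move=> sxy; rewrite /col (ext1 _ _ _ sxy).
have mono c (S : {set 'I_N}) : #|S| = n -> mono_clique col c S ->
    pos_mono_clique s1 c S \/ pos_mono_clique s2 c S.
  move=> cardS mS.
  (* A clique without edges of [E2] is already present in [s1]; one that uses an edge of [E2] has,
     by [sep], no edge of [E1] and is present in [s2]. *)
  have [in1|] := boolP [forall x in S, forall y in S, (x != y) ==> ~~ E2 x y].
    left=> x y xS yS xy; rewrite -(mS x y) // /col.
    move/forall_inP/(_ x xS)/forall_inP/(_ y yS)/implyP/(_ xy): in1 => nE2.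
    have := dom1 x y xy; rewrite dom // (negPf nE2) orbF andbN.
    by case: (s1 x y).
  rewrite negb_forall_in => /exists_inP[a aS]; rewrite negb_forall_in.
  move=> /exists_inP[b bS]; rewrite negb_imply negbK => /andP[ab E2ab].
  right=> x y xS yS xy; rewrite -(mS x y) // /col.
  have nE1 : ~~ E1 x y.
    apply/negP => E1xy; have [u [v [uin vin uv suv]]] := sep x y a b c E1xy E2ab.
    have inS w : w \in [:: x; y; a; b] -> w \in S.
      by rewrite !inE => /or4P[] /eqP->.
    have := mS u v (inS _ uin) (inS _ vin) uv.
    by rewrite (col_built _ _ _ suv); case: (c).
  have := dom1 x y xy; have := dom2 x y xy; rewrite dom // (negPf nE1) /= andbN andbT.
  case s2xy: (s2 x y) => [d|] // _; case s1xy: (s1 x y) => [e|] //= E2xy.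
  case sxy: (s x y) => [f|].
    by rewrite (ext1 _ _ _ sxy) in s1xy; rewrite (ext2 _ _ _ sxy) in s2xy;
       congr Some; congruence.
  by have := dom x y xy; rewrite sxy (negPf nE1) -E2xy.
have [[S [cS mS]]|[S [cS mS]]] := arrow col col_sym.
- have [m1|m2] := mono true S cS mS.
    by case: lose1; left; exists S.
  by case: lose2; left; exists S.
- have [m1|m2] := mono false S cS mS.
    by case: lose1; right; exists S.
  by case: lose2; right; exists S.
Qed.

Lemma card_unordered_rect N (X Y : {set 'I_N}) (E : rel 'I_N) :
  [disjoint X & Y] ->
  (forall x y, x \in X -> y \in Y -> E x y && E y x) ->
  (#|X| * #|Y|).*2 <= #|[set q | (q.1 != q.2) && E q.1 q.2]|.
Proof.
move=> dXY EXY.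
have dis : setX X Y :&: setX Y X = set0.
  apply/setP => -[x y]; rewrite !inE /=; apply/negbTE/negP.
  by move=> /andP[/andP[xX _] /andP[xY _]]; rewrite (disjointFr dXY xX) in xY.
have -> : (#|X| * #|Y|).*2 = #|setX X Y :|: setX Y X|.
  by rewrite cardsU dis cards0 subn0 !cardsX [#|Y| * _]mulnC addnn.
have neq x y : x \in X -> y \in Y -> x != y.
  by move=> xX yY; apply: contraTneq yY => <-; rewrite (disjointFr dXY xX).
apply/subset_leq_card/subsetP => -[x y]; rewrite !inE /=.
case/orP=> /andP[x1 y1].
  by rewrite neq //; case/andP: (EXY _ _ x1 y1).
by rewrite eq_sym neq //; case/andP: (EXY _ _ y1 x1).
Qed.

(** Builder first builds everything outside P x W and A x B. An unbuilt edge of each kind together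
    contain some p, a, b with pa and pb of opposite colours, so no monochromatic clique contains
    both edges and [saves_split] applies. *)
Lemma saves_separated n N G (W P A B : {set 'I_N}) (s : position N) :
  ramsey_arrow n n N -> sym_position s ->
  [disjoint P & W] -> [disjoint A & W] -> [disjoint B & W] ->
  [disjoint P & A] -> [disjoint P & B] -> [disjoint A & B] ->
  (forall w v, w \in W -> v \notin W -> s w v = None) ->
  (forall a b, a \in A -> b \in B -> s a b = None) ->
  (forall p, p \in P -> exists c, (forall a, a \in A -> s p a = Some c) /\
                                  (forall b, b \in B -> s p b = Some (~~ c))) ->
  G <= #|P| * #|W| -> G <= #|A| * #|B| -> saves n G s.
Proof.
move=> arrow s_sym dPW dAW dBW dPA dPB dAB sW sAB sP leW leAB.
pose E1 : rel 'I_N := fun x y => (x \in P) && (y \in W) || (x \in W) && (y \in P).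
pose E2 : rel 'I_N := fun x y => (x \in A) && (y \in B) || (x \in B) && (y \in A).
have E1_sym : symmetric E1 by move=> x y; rewrite /E1 orbC andbC [(x \in P) && _]andbC.
have E2_sym : symmetric E2 by move=> x y; rewrite /E2 orbC andbC [(x \in A) && _]andbC.
pose E : rel 'I_N := fun x y => ~~ (E1 x y || E2 x y).
have E_sym : symmetric E by move=> x y; rewrite /E E1_sym E2_sym.
apply: (saves_batch E_sym s_sym) => s' [s'_sym ext dom].
apply: (saves_split (E1 := E1) (E2 := E2) arrow) => //.
- move=> x y xy; rewrite dom // negbK; apply/andb_idl.
  case/orP=> /orP[] /andP[x1 y1].
  + by rewrite s_sym sW // (disjointFr dPW).
  + by rewrite sW // (disjointFr dPW).
  + by rewrite sAB.
  + by rewrite s_sym sAB.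
- move=> x y; apply/negP => /andP[] /orP[] /andP[x1 y1] /orP[] /andP[x2 y2].
  + by rewrite (disjointFr dBW y2) in y1.
  + by rewrite (disjointFr dAW y2) in y1.
  + by rewrite (disjointFr dAW x2) in x1.
  + by rewrite (disjointFr dBW x2) in x1.
- move=> x y a b c E1xy E2ab.
  have [p pP pxy] : exists2 p, p \in P & p \in [:: x; y].
    by case/orP: E1xy => /andP[x1 y1]; [exists x|exists y]; rewrite // !inE eqxx ?orbT.
  have [a' a'A a'ab] : exists2 a', a' \in A & a' \in [:: a; b].
    by case/orP: E2ab => /andP[a1 b1]; [exists a|exists b]; rewrite // !inE eqxx ?orbT.
  have [b' b'B b'ab] : exists2 b', b' \in B & b' \in [:: a; b].
    by case/orP: E2ab => /andP[a1 b1]; [exists b|exists a]; rewrite // !inE eqxx ?orbT.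
  have inl z : z \in [:: x; y] -> z \in [:: x; y; a; b].
    by rewrite !inE => /orP[] ->; rewrite ?orbT.
  have inr z : z \in [:: a; b] -> z \in [:: x; y; a; b].
    by rewrite !inE => /orP[] ->; rewrite ?orbT.
  have neq (X : {set 'I_N}) v : [disjoint P & X] -> v \in X -> p != v.
    by move=> dPX; apply: contraTneq => <-; rewrite (disjointFr dPX pP).
  have [d [pA pB]] := sP p pP.
  (* The edges from [p] to [a'] and to [b'] differ in colour, so one of them has colour [~~ c]. *)
  have [dc|dc] := eqVneq d (~~ c).
    exists p, a'; split; [exact: inl|exact: inr|exact: neq dPA _|].
    by apply: ext; rewrite pA // dc.
  exists p, b'; split; [exact: inl|exact: inr|exact: neq dPB _|].
  by apply: ext; rewrite pB //; case: (d) (c) dc => -[].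
- apply: leq_trans (card_unordered_rect dPW _); first by rewrite leq_double.
  by move=> x y xP yW; rewrite /E1 xP yW orbT.
- apply: leq_trans (card_unordered_rect dAB _); first by rewrite leq_double.
  by move=> x y xP yW; rewrite /E2 xP yW orbT.
Qed.

(** * The search for P, A and B *)

(** [x] and [y] count by colour the neighbours of a vertex of A in A and in B. Without a balanced
    choice, one colour misses the share 1/(d+2) in both sets, so the other one dominates both.
    Asking for d/(d+2) instead of (d+1)/(d+2) leaves room, by [d.+2 <= a], for the vertex itself,
    which A loses. *)
Lemma balanced_or_biased d a b (x y : bool -> nat) :
  0 < d -> d.+2 <= a -> (x true + x false).+1 = a -> y true + y false = b ->
  (exists c, a <= x c * d.+2 /\ b <= y (~~ c) * d.+2) \/
  (exists c, a * d <= x c * d.+2 /\ b * d <= y c * d.+2).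
Proof.
move=> d0 le_a xa yb.
have ex : x true * d.+2 + x false * d.+2 + d.+2 = a * d + a + a.
  by rewrite -mulnDl addnC -mulSn xa !mulnS addnA addnC addnA.
have ey : y true * d.+2 + y false * d.+2 = b * d + b + b.
  by rewrite -mulnDl yb !mulnS addnA addnC addnA.
have le_ad : a <= a * d by rewrite leq_pmulr.
have le_bd : b <= b * d by rewrite leq_pmulr.
pose X c := x c * d.+2; pose Y c := y c * d.+2.
suff: (exists c, a <= X c /\ b <= Y (~~ c)) \/
      (exists c, a * d <= X c /\ b * d <= Y c) by [].
move: ex ey; rewrite -/(X true) -/(X false) -/(Y true) -/(Y false).
move: {x y xa yb d0} (a * d) (b * d) le_ad le_bd X Y => ad bd le_ad le_bd X Y ex ey.
have [xt|xt] := leqP a (X true); have [xf|xf] := leqP a (X false).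
- have [yf|yf] := leqP b (Y false); first by left; exists true.
  by left; exists false; split=> //=; lia.
- have [yf|yf] := leqP b (Y false); first by left; exists true.
  by right; exists true; lia.
- have [yt|yt] := leqP b (Y true); first by left; exists false.
  by right; exists false; lia.
- by exfalso; lia.
Qed.

Lemma disjoint_setU1 (T : finType) (x : T) (A B : {set T}) :
  [disjoint x |: A & B] = (x \notin B) && [disjoint A & B].
Proof. by rewrite !disjoints_subset subUset sub1set inE. Qed.

(* [g] and [b] bound the vertices still to be added to [P] and to the cliques
   [K true] (red) and [K false] (blue): each of the former costs [A] and [B] a
   factor [d.+2], each of the latter a factor [d.+2 / d]. *)
Lemma saves_of_search n N G h L d (W : {set 'I_N}) k g b (s : position N)
    (P A B : {set 'I_N}) (K : bool -> {set 'I_N}) :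
  ramsey_arrow n n N -> 0 < d -> d.+2 <= L ->
  G <= h * #|W| -> G <= L * L -> G <= #|W| * #|~: W| ->
  g + b < k ->
  sym_position s ->
  [disjoint P & W] -> [disjoint A & W] -> [disjoint B & W] ->
  [disjoint P & A] -> [disjoint P & B] -> [disjoint A & B] ->
  (forall w v, w \in W -> v \notin W -> s w v = None) ->
  (forall x y, x \in A -> y \in B -> s x y = None) ->
  (forall p, p \in P -> exists c, (forall x, x \in A -> s p x = Some c) /\
                                  (forall y, y \in B -> s p y = Some (~~ c))) ->
  (forall c, pos_mono_clique s c (K c)) ->
  (forall c x z, x \in K c -> z \in A :|: B -> s x z = Some c) ->
  (forall c, #|K c| <= n) -> (forall c, [disjoint K c & A :|: B]) ->
  h <= g + #|P| -> n.*2 <= b + #|K true| + #|K false| ->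
  L * d.+2 ^ (g + b) <= #|A| * d ^ b -> L * d.+2 ^ (g + b) <= #|B| * d ^ b ->
  saves n G s.
Proof.
move=> arrow d0 dL GW GL GWC; elim: k g b s P A B K => // k IH g b s P A B K.
rewrite ltnS => le_k s_sym dPW dAW dBW dPA dPB dAB sW sAB sP Kmono KAB Kn dK hP nK LA LB.
(* As [d ^ b <= d.+2 ^ (g + b)], the size invariant keeps [A] and [B] at size at least [L]
   throughout. *)
have ge_L e : L * d.+2 ^ (g + b) <= e * d ^ b -> L <= e.
  move=> le_e; rewrite -(@leq_pmul2r (d ^ b)) ?expn_gt0 ?d0 //.
  apply: leq_trans le_e; rewrite leq_mul2l; apply/orP; right.
  apply: (@leq_trans (d.+2 ^ b)).
    by case: (posnP b) => [->|b0]; rewrite ?expn0 // leq_exp2r //; lia.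
  by rewrite leq_pexp2l // leq_addl.
have [le_hP|lt_Ph] := leqP h #|P|.
  apply: (saves_separated arrow s_sym dPW dAW dBW dPA dPB dAB sW sAB sP).
    by apply: leq_trans GW _; rewrite leq_mul2r le_hP orbT.
  by apply: leq_trans GL _; apply: leq_mul; apply: ge_L.
(* A finished clique wins without a further turn, while all edges between [W] and its complement are
   still unbuilt. *)
have [|noK] := boolP [exists c, #|K c| == n].
  case/existsP=> c /eqP Kc; exists 0; split.
    rewrite add0n; apply: leq_trans (_ : (#|W| * #|~: W|).*2 <= _); first by rewrite leq_double.
    have dWC : [disjoint W & ~: W] by rewrite -setI_eq0 setICr.
    apply: leq_trans (card_unordered_rect (E := fun x y => s x y == None) dWC _) _.
      by move=> x y xW; rewrite inE => yW; rewrite (s_sym y) sW.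
    by apply/subset_leq_card/subsetP => -[x y]; rewrite !inE.
  by apply: bww_won; case: c Kc => Kc; [left; exists (K true)|right; exists (K false)].
have Kn' c : #|K c| < n.
  rewrite ltn_neqAle Kn andbT; apply: contra noK => Kc.
  by apply/existsP; exists c.
(* Neither budget is exhausted: [g = 0] would give [h <= #|P|], and [b = 0] would force a clique of
   size [n]. *)
case: g => [|g] in le_k hP LA LB ge_L *.
  by move: hP; rewrite leqNgt lt_Ph.
case: b => [|b] in le_k nK LA LB ge_L *.
  move: nK; rewrite add0n leqNgt -addnn -addSn => /negP[].
  by apply: leq_add; last exact: ltnW.
have LA' := ge_L _ LA; have LB' := ge_L _ LB.
have [y yA] : exists y, y \in A by apply/card_gt0P; apply: leq_trans LA'; apply: leq_trans dL.
pose E : rel 'I_N := fun u v => (u == y) && (v \in A :|: B) || (v == y) && (u \in A :|: B).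
have E_sym : symmetric E by move=> u v; rewrite /E orbC.
apply: (saves_batch E_sym s_sym) => s' [s'_sym ext dom].
pose A' c := [set z in A :\ y | s' y z == Some c].
pose B' c := [set z in B | s' y z == Some c].
have A'A c : A' c \subset A by apply/subsetP => z; rewrite !inE => /andP[/andP[]].
have B'B c : B' c \subset B by apply/subsetP => z; rewrite !inE => /andP[].
have A'Ay c : A' c \subset A :\ y by apply/subsetP => z; rewrite inE => /andP[].
have A'B' c e : A' c :|: B' e \subset A :|: B by apply: setUSS.
have yB : y \notin B by rewrite (disjointFr dAB yA).
have asked z : z != y -> z \in A :|: B -> s' y z != None.
  by move=> zy zAB; rewrite dom 1?eq_sym // negb_and negbK /E eqxx zAB orbT.
have cardA : (#|A' true| + #|A' false|).+1 = #|A|.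
  rewrite (cardsD1 y A) yA add1n; congr _.+1.
  rewrite -(cardsID [set z | s' y z == Some true] (A :\ y)); congr (_ + _).
    by apply: eq_card => z; rewrite !inE.
  apply: eq_card => z; rewrite !inE.
  have [-> //=|zy] := eqVneq z y; first by rewrite andbF.
  case zA: (z \in A) => //=; last by rewrite andbF.
  by have := asked z zy; rewrite inE zA => /(_ isT); case: (s' y z) => [[]|].
have cardB : #|B' true| + #|B' false| = #|B|.
  rewrite -(cardsID [set z | s' y z == Some true] B); congr (_ + _).
    by apply: eq_card => z; rewrite !inE.
  apply: eq_card => z; rewrite !inE.
  case zB: (z \in B) => //=; last by rewrite andbF.
  have zy : z != y by apply: contraTneq zB => ->.
  by have := asked z zy; rewrite inE zB orbT => /(_ isT); case: (s' y z) => [[]|].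
have Ey u v : u \notin A :|: B -> E u v = false.
  move=> uAB; rewrite /E (negPf uAB) andbF orbF; apply/negbTE; rewrite negb_and.
  by apply/orP; left; apply: contraNneq uAB => ->; rewrite inE yA.
have yW : y \notin W by rewrite (disjointFr dAW yA).
have s'W w v : w \in W -> v \notin W -> s' w v = None.
  move=> wW vW; have wv : w != v by apply: contraNneq vW => <-.
  apply/eqP; rewrite dom // sW // eqxx Ey // inE negb_or.
  by rewrite (disjointFl dAW wW) (disjointFl dBW wW).
have s'AB (X Y : {set 'I_N}) : X \subset A :\ y -> Y \subset B ->
    forall x z, x \in X -> z \in Y -> s' x z = None.
  move=> XA YB x z /(subsetP XA); rewrite !inE => /andP[xy xA] /(subsetP YB) zB.
  have xz : x != z by apply: contraTneq zB => <-; rewrite (disjointFr dAB xA).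
  have zy : z != y by apply: contraTneq zB => ->.
  by apply/eqP; rewrite dom // sAB // eqxx /E (negPf xy) (negPf zy).
have [[c [goodA goodB]]|[c [badA badB]]] :
    (exists c, #|A| <= #|A' c| * d.+2 /\ #|B| <= #|B' (~~ c)| * d.+2) \/
    (exists c, #|A| * d <= #|A' c| * d.+2 /\ #|B| * d <= #|B' c| * d.+2).
- by apply: balanced_or_biased => //; apply: leq_trans LA'.
(* Balanced case: [y] moves to [P] and [g] drops by one. *)
- apply: (IH g b.+1 s' (y |: P) (A' c) (B' (~~ c)) K) => //.
  + by rewrite disjoint_setU1 yW.
  + exact: disjointWl (A'A c) dAW.
  + exact: disjointWl (B'B _) dBW.
  + by rewrite disjoint_setU1 !inE eqxx /= (disjointWr (A'A c) dPA).
  + by rewrite disjoint_setU1 !inE (negPf yB) (disjointWr (B'B _) dPB).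
  + exact: disjointWl (A'A c) (disjointWr (B'B _) dAB).
  + exact: s'AB (A'Ay c) (B'B _).
  + move=> p; rewrite !inE => /orP[/eqP->|pP].
      by exists c; split=> z; rewrite inE => /andP[_ /eqP].
    have [e [pA pB]] := sP p pP; exists e; split=> z zin; apply: ext.
      by apply: pA; apply: (subsetP (A'A c)).
    by apply: pB; apply: (subsetP (B'B (~~ c))).
  + by move=> e x z xK zK xz; apply: ext; apply: Kmono.
  + by move=> e x z xK /(subsetP (A'B' _ _)) zAB; apply: ext; apply: KAB zAB.
  + by move=> e; apply: disjointWr (A'B' _ _) (dK e).
  + by rewrite cardsU1 (disjointFl dPA yA) add1n addnS.
  + rewrite -(@leq_pmul2r d.+2) // -mulnA -expnSr -addSn mulnAC.
    by apply: leq_trans LA _; rewrite leq_mul2r goodA orbT.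
  + rewrite -(@leq_pmul2r d.+2) // -mulnA -expnSr -addSn mulnAC.
    by apply: leq_trans LB _; rewrite leq_mul2r goodB orbT.
(* Biased case: [y], having been in [A], is joined to [K c] in colour [c], and so are the surviving
   vertices to [y]. The clique grows and [b] drops by one. *)
have yKn e : y \notin K e by rewrite (disjointFl (dK e)) // inE yA.
pose K' e := if e == c then y |: K e else K e.
have cardK' : #|K' true| + #|K' false| = (#|K true| + #|K false|).+1.
  by rewrite /K'; case: (c); rewrite /= cardsU1 yKn add1n ?addSn ?addnS.
apply: (IH g.+1 b s' P (A' c) (B' c) K') => //.
- by rewrite -addnS.
- exact: disjointWl (A'A c) dAW.
- exact: disjointWl (B'B _) dBW.
- exact: disjointWr (A'A c) dPA.
- exact: disjointWr (B'B _) dPB.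
- exact: disjointWl (A'A c) (disjointWr (B'B _) dAB).
- exact: s'AB (A'Ay c) (B'B _).
- move=> p pP; have [e [pA pB]] := sP p pP; exists e; split=> z zin; apply: ext.
    by apply: pA; apply: (subsetP (A'A c)).
  by apply: pB; apply: (subsetP (B'B c)).
- move=> e x z; rewrite /K'; case: eqP => [->|_] xK zK xz; last by apply: ext; apply: Kmono.
  have yK t : t \in K c -> s' t y = Some c.
    by move=> tK; apply: ext; apply: KAB; rewrite // inE yA.
  move: xK zK xz; rewrite !inE => /orP[/eqP->|xK] /orP[/eqP->|zK]; first by rewrite eqxx.
  + by move=> _; rewrite s'_sym yK.
  + by move=> _; rewrite yK.
  + by move=> xz; apply: ext; apply: Kmono.
- move=> e x z; rewrite /K' => xK zAB.
  have zAB' : z \in A :|: B by apply: (subsetP (A'B' c c)).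
  case: eqP xK => [->|_] xK; last by apply: ext; apply: KAB zAB'.
  move: xK; rewrite !inE => /orP[/eqP->|xK]; last by apply: ext; apply: KAB zAB'.
  by move: zAB; rewrite !inE => /orP[] /andP[_ /eqP].
- by move=> e; rewrite /K'; case: ifP => _ //; rewrite cardsU1 yKn add1n.
- move=> e; rewrite /K'; case: ifP => _; last exact: disjointWr (A'B' _ _) (dK e).
  by rewrite disjoint_setU1 (disjointWr (A'B' _ _) (dK e)) !inE eqxx (negPf yB).
- by move: nK; rewrite -[b.+1 + _ + _]addnA -addnA cardK' addSn addnS.
- rewrite -(@leq_pmul2r d.+2) // -mulnA -expnSr -addnS mulnAC.
  by apply: leq_trans LA _; rewrite expnS mulnA leq_mul2r badA orbT.
- rewrite -(@leq_pmul2r d.+2) // -mulnA -expnSr -addnS mulnAC.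
  by apply: leq_trans LB _; rewrite expnS mulnA leq_mul2r badB orbT.
Qed.

(** * An exponential lower bound for the diagonal Ramsey number *)

(** One ordered pair per edge inside [S], so that any function on ordered pairs yields a symmetric
    colouring through its values on such pairs. *)
Definition increasing_pairs N (S : {set 'I_N}) : {set 'I_N * 'I_N} :=
  [set q | [&& q.1 \in S, q.2 \in S & q.1 < q.2]].

Lemma card_increasing_pairs N (S : {set 'I_N}) :
  #|S| * #|S| <= #|increasing_pairs S|.*2 + #|S|.
Proof.
pose sw (q : 'I_N * 'I_N) := (q.2, q.1).
have sw_inj : injective sw by move=> [a b] [c d] [-> ->].
rewrite -cardsX -addnn -[X in _ + X + _](card_imset _ sw_inj).
rewrite -[X in _ + _ + X](card_imset _ (_ : injective (fun x : 'I_N => (x, x)))); last first.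
  by move=> x y [].
apply: leq_trans (leq_add (leq_card_setU _ _) (leqnn _)).
apply: leq_trans (leq_card_setU _ _); apply/subset_leq_card/subsetP => -[x y].
rewrite !inE /= => /andP[xS yS].
have [xy|yx|exy] := ltngtP x y.
- by rewrite xS yS.
- apply/orP; left; apply/orP; right; apply/imsetP.
  by exists (y, x); rewrite // inE /= yS xS.
- by apply/orP; right; apply/imsetP; exists x => //; rewrite (val_inj exy).
Qed.

(** A random colouring takes the value [c] on all of [D] with probability 2^(-|D|), stated without
    division. *)
Lemma card_constant_on (T : finType) (D : {set T}) (c : bool) :
  #|[set f : {ffun T -> bool} | [forall q in D, f q == c]]| * 2 ^ #|D| = 2 ^ #|T|.
Proof.
pose F q : pred bool := if q \in D then pred1 c else predT.
have -> : #|[set f : {ffun T -> bool} | [forall q in D, f q == c]]| = #|finfun.family F|.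
  apply: eq_card => f; rewrite inE; apply/forall_inP/familyP => h q.
    by rewrite /F; case: ifP => // /h.
  by move=> qD; have := h q; rewrite /F qD.
rewrite card_family foldrE big_map big_enum /= (bigID (mem D)) /= big1 => [|q qD].
  rewrite mul1n (eq_bigr (fun=> 2)) => [|q /negPf qD]; last by rewrite /F qD card_bool.
  by rewrite prod_nat_const -expnD -(cardC (mem D)) addnC.
by rewrite /F qD card1.
Qed.

(* Union bound over the monochromatic [n]-sets of a random colouring. *)
Lemma ramsey_arrow_gt n m N : m.*2.+3 <= n -> ramsey_arrow n n N -> 2 ^ m < N.
Proof.
move=> le_mn arrow; rewrite ltnNge; apply/negP => le_N.
pose T := {ffun 'I_N * 'I_N -> bool}.
pose bad S c := [set f : T | [forall q in increasing_pairs S, f q == c]].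
pose d := (n * n.-1)./2.
have dE : d.*2 = n * n.-1.
  rewrite /d -{2}[n * n.-1]odd_double_half oddM.
  by case: n {le_mn arrow bad d} => //= n; rewrite andNb.
have card_bad (S : {set 'I_N}) c : #|S| = n -> #|bad S c| * 2 ^ d <= 2 ^ #|{: 'I_N * 'I_N}|.
  move=> cardS; rewrite -(card_constant_on (increasing_pairs S) c) leq_mul2l leq_exp2l //.
  apply/orP; right; rewrite -leq_double dE; have := card_increasing_pairs S.
  by rewrite cardS; case: (n) => // k; rewrite [k.+1 * k.+1]mulnS addnC leq_add2r.
have cover : [set: T] \subset \bigcup_(S : {set 'I_N} | #|S| == n) (bad S true :|: bad S false).
  apply/subsetP => f _.
  pose col (x y : 'I_N) := f (if x < y then (x, y) else (y, x)).
  have col_sym : sym_colouring col.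
    by move=> x y; rewrite /col; case: (ltngtP x y) => // /val_inj ->.
  have [[S [cS mS]]|[S [cS mS]]] := arrow col col_sym; apply/bigcupP; exists S; rewrite ?cS //.
    rewrite !inE; apply/orP; left; apply/forall_inP => -[x y]; rewrite inE /= => /and3P[xS yS xy].
    have neq : x != y by apply: contraTneq xy => ->; rewrite ltnn.
    by have := mS x y xS yS neq; rewrite /col xy => ->.
  rewrite !inE; apply/orP; right; apply/forall_inP => -[x y]; rewrite inE /= => /and3P[xS yS xy].
  have neq : x != y by apply: contraTneq xy => ->; rewrite ltnn.
  by have := mS x y xS yS neq; rewrite /col xy => ->.
have count : 2 ^ #|{: 'I_N * 'I_N}| * 2 ^ d <= N ^ n * 2 ^ #|{: 'I_N * 'I_N}|.+1.
  have -> : 2 ^ #|{: 'I_N * 'I_N}| = #|[set: T]| by rewrite cardsT card_ffun card_bool.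
  apply: leq_trans (leq_mul (subset_leq_card cover) (leqnn _)) _.
  apply: (@leq_trans (\sum_(S : {set 'I_N} | #|S| == n) 2 ^ #|{: 'I_N * 'I_N}|.+1)).
    elim/big_rec2: _ => [|S u U /eqP cS le_U]; first by rewrite cards0.
    apply: leq_trans (leq_mul (leq_card_setU _ _) (leqnn _)) _.
    rewrite mulnDl; apply: leq_add le_U.
    apply: leq_trans (leq_mul (leq_card_setU _ _) (leqnn _)) _.
    by rewrite mulnDl expnS mul2n -addnn; apply: leq_add; apply: card_bad.
  rewrite sum_nat_const -cardsE card_draws card_ord leq_mul2r.
  apply/orP; right; apply: leq_trans (_ : 'C(N, n) * n`! <= _).
    by rewrite leq_pmulr // fact_gt0.
  rewrite bin_ffact ffact_prod -[X in _ <= _ ^ X]card_ord -prod_nat_const.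
  by apply: leq_prod => i _; apply: leq_subr.
move: count; rewrite expnS mulnA [_ * 2 ^ d]mulnC leq_pmul2r ?expn_gt0 // => count.
(* [N <= 2 ^ m] would give n(n-1)/2 <= mn + 1, whereas 2m + 3 <= n gives n(n-1)/2 >= mn + n. *)
have : 2 ^ d <= 2 ^ (m * n).+1.
  apply: leq_trans count _; rewrite expnS mulnC leq_mul2l /= expnM leq_exp2r //.
  by lia.
rewrite leq_exp2l // -leq_double dE; case: (n) le_mn => // k le_k.
by rewrite mulSn /=; nia.
Qed.

(** * Parameters and start of the search *)

(** Bernoulli: (d/(d+2))^k >= 1 - 2k/(d+2) >= 1/2. Thus [k] biased steps together cost [A] and [B]
    at most a factor 2. *)
Lemma bernoulli_ratio d k : 4 * k <= d.+2 -> d.+2 ^ k <= 2 * d ^ k.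
Proof.
move=> le_k.
have bern : d.+2 ^ k * d.+2 <= d ^ k * d.+2 + 2 * k * d.+2 ^ k.
  elim: k {le_k} => [|k IH]; first by rewrite !expn0 muln0 addn0.
  have le_e : d ^ k <= d.+2 ^ k by case: k {IH} => // k; rewrite leq_exp2r // ltnW.
  rewrite !expnS; move: (d ^ k) (d.+2 ^ k) IH le_e => x y IH le_e; nia.
rewrite -(@leq_pmul2r d.+2) //; move: (d ^ k) (d.+2 ^ k) bern => x y; nia.
Qed.

(** The [h] balanced steps cost a factor 2^(10h) and the [k * (8 * h)] biased ones at most 2^(8h);
    318 = 300 + 10 + 8. *)
Lemma search_size d k h q :
  4 * k <= d.+2 -> d.+2 = 2 ^ 10 -> 2 ^ (318 * h) <= q ->
  2 ^ (300 * h) * d.+2 ^ (h + k * (8 * h)) <= q * d ^ (k * (8 * h)).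
Proof.
move=> le_k dE le_q; rewrite expnD mulnA [d.+2 ^ (_ * _)]expnM.
apply: (@leq_trans (2 ^ (300 * h) * d.+2 ^ h * (2 * d ^ k) ^ (8 * h))).
  rewrite leq_mul2l; apply/orP; right.
  by case: (h) => // h'; rewrite leq_exp2r //; apply: bernoulli_ratio.
rewrite expnMn -expnM mulnA leq_mul2r; apply/orP; right.
rewrite dE -expnM -!expnD; apply: leq_trans le_q.
by rewrite leq_exp2l //; lia.
Qed.

Lemma card_initial_segment N k : k <= N -> #|[set x : 'I_N | x < k]| = k.
Proof.
move=> le_k; have wI : injective (widen_ord le_k).
  by move=> x y /(congr1 val) /= exy; apply: val_inj.
rewrite -[RHS]card_ord -cardsT -(card_imset _ wI).
apply: eq_card => x; rewrite inE; apply/idP/imsetP => [lt_x|[y _ ->]]; last exact: (ltn_ord y).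
by exists (Ordinal lt_x) => //; apply: val_inj.
Qed.

Lemma saves_empty n N h q d k :
  ramsey_arrow n n N -> 0 < d -> 4 * k <= d.+2 -> d.+2 = 2 ^ 10 -> 2 <= h ->
  n.*2 <= k * (8 * h) -> 2 ^ (318 * h) <= q -> 4 * q <= N -> N <= 2 ^ (320 * h + 320) ->
  saves n (h * q) (@empty_position N).
Proof.
move=> arrow d0 le_k dE h2 le_n le_q le_qN le_N.
pose C j := [set x : 'I_N | x < j].
have cC j : j <= N -> #|C j| = j by apply: card_initial_segment.
have le_hq : h <= q.
  apply: leq_trans (ltnW (ltn_expl h (isT : 1 < 2))) _; apply: leq_trans le_q.
  by rewrite leq_exp2l //; lia.
have sCC : C q \subset C q.*2 by apply/subsetP => x; rewrite !inE; lia.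
have cA : #|C q| = q by apply: cC; lia.
have cAB : #|C q.*2| = q.*2 by apply: cC; lia.
have cB : #|C q.*2 :\: C q| = q by rewrite cardsD (setIidPr sCC) cA cAB; lia.
have cW : #|~: C q.*2| = N - q.*2 by rewrite cardsCs setCK cAB card_ord.
have size_q := search_size le_k dE le_q.
(* [A] and [B] are the first and the second [q] vertices, and [W] is the rest, at least [2 * q] of
   them. For N of order 2^(320h), the floor [L = 2 ^ (300 * h)] is of order N^(15/16). *)
apply: (@saves_of_search n N (h * q) h (2 ^ (300 * h)) d (~: C q.*2) (h + k * (8 * h)).+1 h
          (k * (8 * h)) (@empty_position N) set0 (C q) (C q.*2 :\: C q) (fun=> set0)) => //.
- by rewrite dE leq_exp2l //; lia.
- by rewrite cW leq_mul2l; apply/orP; right; lia.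
(* [h * q] is at most 2^(321h + 320), hence at most L^2 = 2^(600h) since h >= 2. *)
- rewrite -expnD; apply: (@leq_trans (2 ^ h * 2 ^ (320 * h + 320))).
    by apply: leq_mul; [exact: ltnW (ltn_expl h _)|lia].
  by rewrite -expnD leq_exp2l //; lia.
- by rewrite setCK cW cAB; apply: leq_mul; lia.
- by rewrite disjoints_subset sub0set.
- by rewrite disjoints_subset setCK.
- by rewrite disjoints_subset setCK; apply: subsetDl.
- by rewrite disjoints_subset sub0set.
- by rewrite disjoints_subset sub0set.
- by rewrite disjoints_subset; apply/subsetP => x; rewrite !inE => ->.
- by move=> p; rewrite inE.
- by move=> c x y; rewrite inE.
- by move=> c x y; rewrite inE.
- by move=> c; rewrite cards0.
- by move=> c; rewrite disjoints_subset sub0set.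
- by rewrite leq_addr.
- by rewrite cards0 !addn0.
- by rewrite cA.
- by rewrite cB.
Qed.

(** * From the saved edges to the bound with the logarithm *)

Lemma card_unbuilt_empty N : #|unbuilt (@empty_position N)| <= 'C(N, 2).*2.
Proof.
rewrite bin2 -[in X in _ <= X]muln2.
have -> : (N * N.-1)./2 * 2 = N * N.-1.
  by rewrite muln2 -[RHS]odd_double_half oddM; case: N => //= N; rewrite andNb.
have -> : unbuilt (@empty_position N) = [set: 'I_N * 'I_N] :\: [set (x, x) | x in [set: 'I_N]].
  apply/setP => -[x y]; rewrite !inE /= !andbT; congr (~~ _).
  apply/idP/imsetP => [/eqP->|[z _ [-> ->]]]; last by rewrite eqxx.
  by exists y; rewrite ?inE.
rewrite cardsD setTI card_imset; last by move=> x y [].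
by rewrite !cardsT card_prod !card_ord -subn1 mulnBr muln1.
Qed.

(** Since 2 <= e, the natural logarithm is at most the binary one, which rounding down lowers by
    less than 1. *)
Lemma ln_le_trunc_log N : 0 < N -> (ln (INR N) <= INR (trunc_log 2 N).+1)%R.
Proof.
move=> N0; have lt_N := trunc_log_ltn N (isT : 1 < 2).
have exp_ge a : (INR (2 ^ a) <= exp (INR a))%R.
  elim: a => [|a IH]; first by rewrite exp_0 /=; lra.
  rewrite expnS mult_INR (S_INR a) exp_plus Rmult_comm.
  have e1 := exp_ineq1_le 1.
  by apply: Rmult_le_compat => //; rewrite /=; try exact: pos_INR; lra.
have N_pos : (0 < INR N)%R by apply: lt_0_INR; lia.
rewrite -[X in (_ <= X)%R]ln_exp.
left; apply: ln_increasing => //.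
by apply: (Rlt_le_trans _ _ _ _ (exp_ge _)); apply: lt_INR; apply/ltP.
Qed.

(* tilde r(n,n;N) <= C(N,2) - c N log N  is stated as: Builder can force a
   win within some t turns with t <= C(N,2) - c N ln N (equivalent, since
   tilde r is the least such t). *)
Theorem theorem1p1 :
  exists c : R, (0 < c)%R /\
  exists n0 : nat, 3 <= n0 /\
  forall n N : nat, n0 <= n -> is_ramsey_number n n N ->
    exists t : nat, builder_wins n n N t /\
      (INR t <= INR 'C(N, 2) - c * INR N * ln (INR N))%R.
Proof.
(* 10240 = 8 * 2 * 640, from N <= 8q, ln N <= 2l and l <= 640h. *)
exists (/ 10240)%R; split; first by lra.
(* [3000] gives l >= 1498 and thus h >= 4, more than the required h >= 2. *)
exists 3000; split => // n N le_n [arrow _].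
pose l := trunc_log 2 N; pose h := l %/ 320; pose q := N %/ 4.
have lt_N : 2 ^ (n - 3)./2 < N by apply: (@ramsey_arrow_gt n) => //; lia.
have N0 : 0 < N by apply: leq_trans lt_N.
have le_l : (n - 3)./2 <= l by apply: trunc_log_max => //; apply: ltnW.
have le_h : 320 * h <= l < 320 * h + 320 by rewrite /h; lia.
have le_2l : 2 ^ l <= N by apply: trunc_logP.
have ge_2l : N < 2 ^ l.+1 by apply: trunc_log_ltn.
have [t [le_t win]] : saves n (h * q) (@empty_position N).
  (* [d = 1022] makes [d.+2 = 2 ^ 10], and [k = 256] is the largest value with [4 * k <= d.+2]. The
     biased budget 2048h covers 2n because n <= 2l + 4 and l < 320h + 320. *)
  apply: (@saves_empty n N h q 1022 256) => //; try by lia.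
  - by rewrite leq_divRL //; apply: leq_trans le_2l; rewrite -(expnD 2 _ 2) leq_exp2l //; lia.
  - by apply: leq_trans (ltnW ge_2l) _; rewrite leq_exp2l //; lia.
exists t; split=> //.
have le_tC : (INR t + INR (h * q) <= INR 'C(N, 2))%R.
  rewrite -plus_INR; apply: le_INR; apply/leP.
  by rewrite -leq_double; apply: leq_trans le_t (card_unbuilt_empty N).
suff: (/ 10240 * INR N * ln (INR N) <= INR (h * q))%R by lra.
have ln_l : (ln (INR N) <= INR (2 * l))%R.
  by apply: (Rle_trans _ _ _ (ln_le_trunc_log N0)); apply: le_INR; lia.
have N_ge0 := pos_INR N.
have : (INR N * ln (INR N) <= INR N * INR (2 * l))%R by apply: Rmult_le_compat_l.
have : (INR N * INR (2 * l) <= 10240 * INR (h * q))%R.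
  have -> : 10240%R = INR (64 * 160) by rewrite INR_IZR_INZ.
  rewrite -!mult_INR; apply: le_INR; apply/leP.
  (* Rounding in [N %/ 4] costs at most a factor 2 once N > 4. *)
  have lN : N <= 8 * q.
    have : 2 ^ 2 < N by apply: leq_ltn_trans lt_N; rewrite leq_exp2l //; lia.
    by rewrite /q; move: (N) => M; lia.
  have ll : l <= 640 * h by lia.
  apply: (@leq_trans (8 * q * (2 * (640 * h)))).
    by apply: leq_mul; rewrite // leq_mul2l ll orbT.
  by rewrite mulnCA !mulnA; lia.
by lra.
Qed.
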